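(* The set $\mathcal{C}_3=\{S_{\{i,j\}}:\{i,j\}\subset[8],\ i\neq j\}$ of spanning trees on $[8]$ defined in the context is an $(8,28,5)$ tree-code; that is, $|\mathcal{C}_3|=28$ and the minimum tree-distance between two distinct elements of $\mathcal{C}_3$ is $5$.
   Context: $[n]=\{1,\dots,n\}$. For spanning trees $T_1=([n],E_1)$, $T_2=([n],E_2)$ of the complete graph on $[n]$, the tree-distance is $d(T_1,T_2)=n-1-|E_1\cap E_2|$. An $(n,M,d)$ tree-code is a set of $M$ such spanning trees whose minimum pairwise tree-distance is $d$. For $i\ne j$ in $[8]$ define the $3$-subsets $N_{i,j}$ of $[8]$ as follows (writing $xyz$ for $\{x,y,z\}$): Row 1: $N_{1,2}=457,\ N_{1,3}=256,\ N_{1,4}=358,\ N_{1,5}=678,\ N_{1,6}=248,\ N_{1,7}=346,\ N_{1,8}=237$. Row 2: $N_{2,1}=368,\ N_{2,3}=467,\ N_{2,4}=156,\ N_{2,5}=137,\ N_{2,6}=578,\ N_{2,7}=148,\ N_{2,8}=345$. Row 3: $N_{3,1}=478,\ N_{3,2}=158,\ N_{3,4}=268,\ N_{3,5}=146,\ N_{3,6}=127,\ N_{3,7}=245,\ N_{3,8}=567$. Row 4: $N_{4,1}=267,\ N_{4,2}=378,\ N_{4,3}=157,\ N_{4,5}=128,\ N_{4,6}=235,\ N_{4,7}=568,\ N_{4,8}=136$. Row 5: $N_{5,1}=234,\ N_{5,2}=468,\ N_{5,3}=278,\ N_{5,4}=367,\ N_{5,6}=138,\ N_{5,7}=126,\ N_{5,8}=147$.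 Row 6: $N_{6,1}=357,\ N_{6,2}=134,\ N_{6,3}=458,\ N_{6,4}=178,\ N_{6,5}=247,\ N_{6,7}=238,\ N_{6,8}=125$. Row 7: $N_{7,1}=258,\ N_{7,2}=356,\ N_{7,3}=168,\ N_{7,4}=123,\ N_{7,5}=348,\ N_{7,6}=145,\ N_{7,8}=246$. Row 8: $N_{8,1}=456,\ N_{8,2}=167,\ N_{8,3}=124,\ N_{8,4}=257,\ N_{8,5}=236,\ N_{8,6}=347,\ N_{8,7}=135$. For each $i\neq j$, $N_{i,j}\cap N_{j,i}=\emptyset$ and $N_{i,j}\cup N_{j,i}=[8]\setminus\{i,j\}$. For each pair $\{i,j\}\subset[8]$, $S_{\{i,j\}}$ is the tree on $[8]$ with edge $\{i,j\}$, edges $\{i,k\}$ for $k\in N_{i,j}$, and edges $\{j,k\}$ for $k\in N_{j,i}$. *)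

(* Defs.v *)
From mathcomp Require Import all_boot.

Set Implicit Arguments.
Unset Strict Implicit.
Unset Printing Implicit Defensive.

(* The vertex set [n] = {1, ..., n} is represented by 'I_n: the ordinal x
   stands for the vertex labelled x.+1.  A graph on [n] is given by its set of
   edges, an edge being the 2-element set of its endpoints. *)
Definition graph (n : nat) := {set {set 'I_n}}.

Definition adj (n : nat) (E : graph n) : rel 'I_n :=
  fun x y => [set x; y] \in E.

Definition connected_graph (n : nat) (E : graph n) : Prop :=
  0 < n /\ forall x y : 'I_n, connect (adj E) x y.

(* A cycle of a simple graph has at least 3 vertices; [cycle] alone also
   accepts x, y, x along a single edge. *)
Definition acyclic_graph (n : nat) (E : graph n) : Prop :=
  forall c : seq 'I_n, 2 < size c -> uniq c -> ~~ cycle (adj E) c.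

Definition spanning_tree (n : nat) (E : graph n) : Prop :=
  [/\ forall e, e \in E -> #|e| = 2, connected_graph E & acyclic_graph E].

(* A spanning tree of the complete graph on [n] has n - 1 edges, so the
   subtractions do not truncate when E1 and E2 are such trees. *)
Definition tree_dist (n : nat) (E1 E2 : graph n) : nat :=
  n - 1 - #|E1 :&: E2|.

(* The minimum is over pairs of distinct trees, and it must be attained. *)
Definition min_tree_dist (n : nat) (C : {set graph n}) (d : nat) : Prop :=
  (exists T1 T2 : graph n,
     [/\ T1 \in C, T2 \in C, T1 != T2 & tree_dist T1 T2 = d]) /\
  (forall T1 T2 : graph n,
     T1 \in C -> T2 \in C -> T1 != T2 -> d <= tree_dist T1 T2).

Definition tree_code (n M d : nat) (C : {set graph n}) : Prop :=
  [/\ forall T, T \in C -> spanning_tree T, #|C| = M & min_tree_dist C d].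
Arguments tree_code : clear implicits.

(* The sets N_{i,j}, with the labels 1, ..., 8; the default is a dummy value
   for i = j and for labels out of range. *)
Definition Nlabels (i j : nat) : seq nat :=
  match i, j with
  | 1, 2 => [:: 4; 5; 7]
  | 1, 3 => [:: 2; 5; 6]
  | 1, 4 => [:: 3; 5; 8]
  | 1, 5 => [:: 6; 7; 8]
  | 1, 6 => [:: 2; 4; 8]
  | 1, 7 => [:: 3; 4; 6]
  | 1, 8 => [:: 2; 3; 7]
  | 2, 1 => [:: 3; 6; 8]
  | 2, 3 => [:: 4; 6; 7]
  | 2, 4 => [:: 1; 5; 6]
  | 2, 5 => [:: 1; 3; 7]
  | 2, 6 => [:: 5; 7; 8]
  | 2, 7 => [:: 1; 4; 8]
  | 2, 8 => [:: 3; 4; 5]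
  | 3, 1 => [:: 4; 7; 8]
  | 3, 2 => [:: 1; 5; 8]
  | 3, 4 => [:: 2; 6; 8]
  | 3, 5 => [:: 1; 4; 6]
  | 3, 6 => [:: 1; 2; 7]
  | 3, 7 => [:: 2; 4; 5]
  | 3, 8 => [:: 5; 6; 7]
  | 4, 1 => [:: 2; 6; 7]
  | 4, 2 => [:: 3; 7; 8]
  | 4, 3 => [:: 1; 5; 7]
  | 4, 5 => [:: 1; 2; 8]
  | 4, 6 => [:: 2; 3; 5]
  | 4, 7 => [:: 5; 6; 8]
  | 4, 8 => [:: 1; 3; 6]
  | 5, 1 => [:: 2; 3; 4]
  | 5, 2 => [:: 4; 6; 8]
  | 5, 3 => [:: 2; 7; 8]
  | 5, 4 => [:: 3; 6; 7]
  | 5, 6 => [:: 1; 3; 8]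
  | 5, 7 => [:: 1; 2; 6]
  | 5, 8 => [:: 1; 4; 7]
  | 6, 1 => [:: 3; 5; 7]
  | 6, 2 => [:: 1; 3; 4]
  | 6, 3 => [:: 4; 5; 8]
  | 6, 4 => [:: 1; 7; 8]
  | 6, 5 => [:: 2; 4; 7]
  | 6, 7 => [:: 2; 3; 8]
  | 6, 8 => [:: 1; 2; 5]
  | 7, 1 => [:: 2; 5; 8]
  | 7, 2 => [:: 3; 5; 6]
  | 7, 3 => [:: 1; 6; 8]
  | 7, 4 => [:: 1; 2; 3]
  | 7, 5 => [:: 3; 4; 8]
  | 7, 6 => [:: 1; 4; 5]
  | 7, 8 => [:: 2; 4; 6]
  | 8, 1 => [:: 4; 5; 6]
  | 8, 2 => [:: 1; 6; 7]
  | 8, 3 => [:: 1; 2; 4]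
  | 8, 4 => [:: 2; 5; 7]
  | 8, 5 => [:: 2; 3; 6]
  | 8, 6 => [:: 3; 4; 7]
  | 8, 7 => [:: 1; 3; 5]
  | _, _ => [::]
  end.

Definition Nset (i j : 'I_8) : {set 'I_8} :=
  [set k : 'I_8 | k.+1 \in Nlabels i.+1 j.+1].

Definition S_tree (i j : 'I_8) : graph 8 :=
  [set i; j] |:
    ([set [set i; k] | k in Nset i j] :|: [set [set j; k] | k in Nset j i]).

Lemma S_treeC (i j : 'I_8) : S_tree i j = S_tree j i.
Proof.
by rewrite /S_tree setUC [X in X :|: _]setUC [RHS]setUC (setUC [set j] [set i]).
Qed.

(* The pairs (i, j) and (j, i) give the same tree, by S_treeC. *)
Definition C3 : {set graph 8} :=
  [set S_tree p.1 p.2 | p : 'I_8 * 'I_8 & p.1 != p.2].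

(* Main.v *)
Require Import Defs.
From mathcomp Require Import all_boot.

Set Implicit Arguments.
Unset Strict Implicit.
Unset Printing Implicit Defensive.

(** Each [S_tree i j] is a double star: the centres [i] and [j] are joined, and
every other vertex is a leaf hanging from exactly one of them.  Such a graph is
connected through its centres ([double_star_connected]), and it is acyclic
because a cycle has at least three vertices, hence passes through a leaf, which
has only one neighbour ([double_star_acyclic]).

Since every tree has seven edges, two distinct trees are at distance at least 5
exactly when they share at most two edges ([common_edges_le2]).  The reason
lies in the sets [N_{i,j}].

If {i, j} and {k, l} are disjoint, an edge common to the two trees joins one of
i, j to one of k, l.  In the first tree k and l are leaves, so at most one
common edge ends at k and at most one at l.

If the pairs are {i, j} and {i, k}, the common edges at i lead to the vertices
lying in both blocks, [N_{i,j}] with j added and [N_{i,k}] with k added.  For fixed i, the seven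
blocks are the complements of the lines of a Fano plane on the seven other
vertices, so that two of them meet in exactly two points.  The only other
possible common edge is {j, k}, and it never is one: in the table, k is in
[N_{i,j}] or j is in [N_{i,k}].  Two such trees thus share exactly two edges,
so the bound is attained.

As all these are finite facts about the table, the bound is established by
evaluation over all pairs of trees, the edges being described by a boolean
relation [tree_edge] on natural numbers and counted by [count_pairs], both of
which compute.  The bound also shows that distinct pairs {i, j} give distinct
trees, since a tree shares seven edges with itself; hence there are as many
trees as pairs. *)

Lemma adjC n (E : graph n) x y : adj E x y = adj E y x.
Proof. by rewrite /adj setUC. Qed.

(** A cycle of length at least 3 contains a vertex [k] other than [i] and [j];
its predecessor and successor on the cycle are two distinct neighbours. *)
Lemma double_star_acyclic n (E : graph n) (i j : 'I_n) :
  (forall k x y, k != i -> k != j -> adj E k x -> adj E k y -> x = y) ->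
  acyclic_graph E.
Proof.
move=> leaf c c_gt2 c_uniq; apply/negP=> c_cycle.
have /hasP[k kc /andP[ki kj]] : has (fun k => (k != i) && (k != j)) c.
  apply: contraLR c_gt2; rewrite -leqNgt => /hasPn sub_ij.
  apply: (@uniq_leq_size _ c [:: i; j]) => // k /sub_ij.
  by rewrite !inE negb_and !negbK.
(* Rotate the cycle so that it starts at the leaf [k]. *)
have [r s rotc] := rot_to kc.
rewrite -(rot_cycle r) rotc in c_cycle.
rewrite -(rot_uniq r) rotc in c_uniq.
rewrite -(size_rot r) rotc in c_gt2.
case: s => [|x [|y s]] // in rotc c_gt2 c_uniq c_cycle *.
move: c_cycle; rewrite /= rcons_path => /and3P[kx _ /andP[_ zk]].
rewrite adjC in zk.
have x_last := leaf _ _ _ ki kj kx zk.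
by move: c_uniq; rewrite /= [in x \notin _]x_last mem_last andbF.
Qed.

Lemma double_star_connected n (E : graph n) (i j : 'I_n) :
  adj E i j ->
  (forall k, k != i -> k != j -> adj E i k || adj E j k) ->
  connected_graph E.
Proof.
move=> ij covered; split; first exact: leq_ltn_trans (ltn_ord i).
have sym : connect_sym (adj E) by apply: sym_connect_sym => x y; apply: adjC.
suff from_i k : connect (adj E) i k.
  by move=> x y; apply: connect_trans (from_i y); rewrite sym.
have [-> //|ki] := eqVneq k i.
have [->|kj] := eqVneq k j; first exact: connect1.
have /orP[ik|jk] := covered k ki kj; first exact: connect1.
by apply: connect_trans (connect1 jk); apply: connect1.
Qed.

Lemma eq_set2 (T : finType) (x y a b : T) :
  ([set x; y] == [set a; b]) =
  ((x == a) && (y == b)) || ((x == b) && (y == a)).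
Proof.
apply/eqP/orP => [e|[]/andP[/eqP-> /eqP->] //]; last exact: setUC.
have xab : x \in [set a; b] by rewrite -e set21.
have yab : y \in [set a; b] by rewrite -e set22.
have axy : a \in [set x; y] by rewrite e set21.
have bxy : b \in [set x; y] by rewrite e set22.
move: xab yab axy bxy; rewrite !inE (eq_sym a) (eq_sym b) (eq_sym a y) (eq_sym b y).
by case: (x == a); case: (x == b); case: (y == a); case: (y == b) => //=; auto.
Qed.

(** The edge is oriented from the centre [x = i]; arguments are vertices,
numbered from 0, whereas [Nlabels] uses labels, numbered from 1. *)
Definition spoke (i j x y : nat) : bool :=
  (x == i) && ((y == j) || (y.+1 \in Nlabels i.+1 j.+1)).

Definition tree_edge (i j x y : nat) : bool :=
  [|| spoke i j x y, spoke i j y x, spoke j i x y | spoke j i y x].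

Lemma mem_imset_set2 (T : finType) (i x y : T) (N : {set T}) :
  ([set x; y] \in [set [set i; k] | k in N]) =
  ((x == i) && (y \in N)) || ((y == i) && (x \in N)).
Proof.
apply/imsetP/orP => [[k kN /eqP]|].
  rewrite eq_set2 => /orP[]/andP[/eqP-> /eqP->]; rewrite eqxx kN; by auto.
by case=> /andP[/eqP-> kN]; [exists y | exists x; rewrite // setUC].
Qed.

Lemma adj_S_tree (i j x y : 'I_8) : adj (S_tree i j) x y = tree_edge i j x y.
Proof.
rewrite /adj !inE !mem_imset_set2 !inE eq_set2 /tree_edge /spoke.
rewrite -!(inj_eq val_inj) /=.
case: (x == i :> nat); case: (x == j :> nat); case: (y == i :> nat);
  case: (y == j :> nat); by rewrite /= ?orbT ?orbF ?andbF.
Qed.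

(** Turns a check by evaluation over [iota 0 n] into a statement about all
vertices. *)
Lemma forall_ord n (P : pred nat) : all P (iota 0 n) -> forall i : 'I_n, P i.
Proof. by move=> /allP allP i; apply: allP; rewrite mem_iota ltn_ord. Qed.

(** No vertex [i] lies in [N_{i,j}] or [N_{j,i}], so no edge degenerates to a
singleton. *)
Lemma S_tree_card2 (i j : 'I_8) e : i != j -> e \in S_tree i j -> #|e| = 2.
Proof.
move=> ij; rewrite !inE => /orP[/eqP->|]; first by rewrite cards2 ij.
have check : all (fun a => all (fun b => (a.+1 \notin Nlabels a.+1 b.+1)
    && (a.+1 \notin Nlabels b.+1 a.+1)) (iota 0 8)) (iota 0 8) by vm_compute.
case/orP=> /imsetP[k]; rewrite inE => kN ->; rewrite cards2; case: eqVneq => // e'.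
  by case/andP: (forall_ord (forall_ord check i) j); rewrite {1}e' kN.
by case/andP: (forall_ord (forall_ord check j) i); rewrite {1}e' kN.
Qed.

Definition count_pairs (n : nat) (q : nat -> nat -> bool) : nat :=
  sumn [seq count [pred y | (x < y) && q x y] (iota 0 n) | x <- iota 0 n].

Lemma card_ltn_pairs n (q : nat -> nat -> bool) :
  #|[set p : 'I_n * 'I_n | (p.1 < p.2) && q p.1 p.2]| = count_pairs n q.
Proof.
rewrite /count_pairs sumnE big_map -val_enum_ord big_map big_enum /=.
rewrite -sum1_card (eq_bigl (fun p : 'I_n * 'I_n => (p.1 < p.2) && q p.1 p.2));
  last by move=> p; rewrite inE.
rewrite -(pair_big_dep xpredT (fun x y : 'I_n => (x < y) && q x y) (fun _ _ => 1)) /=.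
apply: eq_bigr => x _.
by rewrite count_map -sum1_count big_enum_cond.
Qed.

(** A 2-set of ordinals is [set x; y] for a unique pair [x < y], so edges can
be counted as ordered pairs. *)
Lemma card_graph n (E : graph n) :
  (forall e, e \in E -> #|e| = 2) ->
  #|E| = #|[set p : 'I_n * 'I_n | (p.1 < p.2) && adj E p.1 p.2]|.
Proof.
move=> E2; set P := [set p | _].
have -> : E = [set [set p.1; p.2] | p in P].
  apply/setP => e; apply/idP/imsetP => [eE|[p]]; last first.
    by rewrite inE => /andP[_ pE] ->.
  have /eqP/cards2P[x [y [xy e_xy]]] := E2 e eE.
  rewrite e_xy in eE *.
  case: (ltngtP x y) => [lt_xy|lt_yx|/val_inj x_y].
  - by exists (x, y); rewrite // inE lt_xy.
  - by exists (y, x); [rewrite inE lt_yx adjC | apply: setUC].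
  - by rewrite x_y eqxx in xy.
apply: card_in_imset => -[x y] [a b]; rewrite !inE /= => /andP[xy _] /andP[ab _].
move/eqP; rewrite eq_set2 => /orP[]/andP[/eqP e1 /eqP e2]; rewrite e1 e2 // in xy *.
by move: (ltn_trans xy ab); rewrite ltnn.
Qed.

Definition common_edges (i j k l : nat) : nat :=
  count_pairs 8 (fun x y => tree_edge i j x y && tree_edge k l x y).

Lemma card_common_edges (i j k l : 'I_8) : i != j ->
  #|S_tree i j :&: S_tree k l| = common_edges i j k l.
Proof.
move=> ij; rewrite card_graph => [|e /setIP[eS _]]; last exact: S_tree_card2 eS.
rewrite /common_edges -card_ltn_pairs; apply: eq_card => p; rewrite !inE.
by rewrite -!adj_S_tree /adj in_setI.
Qed.

Lemma S_tree_leaf (i j k x y : 'I_8) : k != i -> k != j ->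
  adj (S_tree i j) k x -> adj (S_tree i j) k y -> x = y.
Proof.
rewrite !adj_S_tree => ki kj kx ky; apply: val_inj; apply/eqP.
have check : all (fun i => all (fun j => all (fun k => all (fun x =>
  all (fun y => [&& k != i, k != j, tree_edge i j k x & tree_edge i j k y]
    ==> (x == y)) (iota 0 8)) (iota 0 8)) (iota 0 8)) (iota 0 8)) (iota 0 8).
  by vm_compute.
have := forall_ord (forall_ord (forall_ord (forall_ord (forall_ord check i) j) k) x) y.
by move=> /implyP; apply; rewrite kx ky !(inj_eq val_inj) ki kj.
Qed.

Lemma S_tree_covered (i j k : 'I_8) : i != j -> k != i -> k != j ->
  adj (S_tree i j) i k || adj (S_tree i j) j k.
Proof.
rewrite !adj_S_tree => ij ki kj.
have check : all (fun i => all (fun j => all (fun k => [&& i != j, k != i & k != j]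
    ==> tree_edge i j i k || tree_edge i j j k) (iota 0 8)) (iota 0 8)) (iota 0 8).
  by vm_compute.
have := forall_ord (forall_ord (forall_ord check i) j) k.
by move=> /implyP; apply; rewrite !(inj_eq val_inj) ij ki kj.
Qed.

Lemma S_tree_spanning (i j : 'I_8) : i != j -> spanning_tree (S_tree i j).
Proof.
move=> ij; split=> [e||]; first exact: S_tree_card2.
  apply: (@double_star_connected _ _ i j) => [|k]; last exact: S_tree_covered.
  by rewrite /adj !inE eqxx.
by apply: double_star_acyclic => k x y; apply: S_tree_leaf.
Qed.

(** Listing each unordered pair by its increasing enumeration makes
[(i, j) != (k, l)] mean that the two trees have different pairs of centres. *)
Lemma common_edges_le2 (i j k l : 'I_8) :
  i < j -> k < l -> (i, j) != (k, l) -> #|S_tree i j :&: S_tree k l| <= 2.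
Proof.
move=> ij kl; rewrite card_common_edges ?neq_ltn ?ij // => ijkl.
have check : all (fun i => all (fun j => all (fun k => all (fun l =>
  [&& i < j, k < l & (i, j) != (k, l)] ==> (common_edges i j k l <= 2))
    (iota 0 8)) (iota 0 8)) (iota 0 8)) (iota 0 8).
  by vm_compute.
have := forall_ord (forall_ord (forall_ord (forall_ord check i) j) k) l.
by move=> /implyP; apply; rewrite ij kl !xpair_eqE !(inj_eq val_inj) -xpair_eqE.
Qed.

Lemma S_tree_edges (i j : 'I_8) : i != j -> #|S_tree i j| = 7.
Proof.
move=> ij; rewrite -[S_tree i j]setIid card_common_edges //; apply/eqP.
have check : all (fun i => all (fun j => (i != j) ==> (common_edges i j i j == 7))
    (iota 0 8)) (iota 0 8).
  by vm_compute.
by have /implyP := forall_ord (forall_ord check i) j; apply.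
Qed.

(** Equal trees would share all their seven edges, more than two. *)
Lemma S_tree_inj : {in [set p : 'I_8 * 'I_8 | p.1 < p.2] &,
  injective (fun p => S_tree p.1 p.2)}.
Proof.
move=> [i j] [k l]; rewrite !inE /= => ij kl eqS; apply/eqP/negPn/negP=> ijkl.
have := common_edges_le2 ij kl ijkl.
by rewrite -eqS setIid S_tree_edges // neq_ltn ij.
Qed.

Lemma C3_ltn : C3 = [set S_tree p.1 p.2 | p in [set p : 'I_8 * 'I_8 | p.1 < p.2]].
Proof.
apply/setP=> T; apply/imsetP/imsetP => -[[i j]]; rewrite inE /= => ij ->.
  have := ij; rewrite neq_ltn => /orP[lt_ij|lt_ji].
    by exists (i, j); rewrite ?inE.
  by exists (j, i); rewrite ?inE // S_treeC.
by exists (i, j); rewrite // inE neq_ltn ij.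
Qed.

Theorem mainTheorem7 : tree_code 8 28 5 C3.
Proof.
split.
- by move=> T /imsetP[p]; rewrite inE => ij ->; apply: S_tree_spanning.
- rewrite C3_ltn card_in_imset; last exact: S_tree_inj.
  rewrite -[RHS]/(count_pairs 8 (fun _ _ => true)) -card_ltn_pairs.
  by apply: eq_card => p; rewrite !inE andbT.
split.
- (* The trees with centres {1, 2} and {1, 3} have exactly the edges {1, 2} and
     {1, 5} in common. *)
  pose a : 'I_8 := @Ordinal 8 0 isT; pose b : 'I_8 := @Ordinal 8 1 isT.
  pose c : 'I_8 := @Ordinal 8 2 isT.
  have common : #|S_tree a b :&: S_tree a c| = 2 by rewrite card_common_edges.
  exists (S_tree a b), (S_tree a c); split.
  + by apply/imsetP; exists (a, b); rewrite ?inE.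
  + by apply/imsetP; exists (a, c); rewrite ?inE.
  + by apply/eqP => eqS; move: common; rewrite -eqS setIid S_tree_edges.
  + by rewrite /tree_dist common.
move=> T1 T2; rewrite C3_ltn => /imsetP[[i j]]; rewrite inE /= => ij ->.
move=> /imsetP[[k l]]; rewrite inE /= => kl -> neqS.
have le2 : #|S_tree i j :&: S_tree k l| <= 2.
  apply: common_edges_le2 => //; apply: contraNneq neqS => -[-> ->]; exact: eqxx.
exact: (leq_sub2l 7 le2).
Qed.
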